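(* For any numerical semigroup $H$ one has $\operatorname{res}(H)\leq n(H)$, with equality if and only if $\operatorname{tr}(H)=\mathcal{C}_H$.
   Context: A numerical semigroup $H$ is a submonoid of $(\mathbb{N},+)$ (with $0\in\mathbb{N}$) such that $\mathbb{N}\setminus H$ is finite; it is assumed that its minimal number of generators is greater than $1$ (i.e. $H\neq\mathbb{N}$). $M=H\setminus\{0\}$. The elements of $G(H)=\mathbb{N}\setminus H$ are the gaps of $H$, and the Frobenius number $F(H)$ is the largest integer not in $H$. The set of pseudo-Frobenius numbers is $PF(H)=\{f\in G(H): f+M\subseteq H\}$. The canonical ideal of $H$ is $\Omega_H=\{-f+h : f\in PF(H),\ h\in H\}\subset\mathbb{Z}$, and the anti-canonical ideal is $\Omega_H^{-1}=\{x\in\mathbb{Z}: x+\Omega_H\subseteq H\}$. The trace of $H$ is $\operatorname{tr}(H)=\Omega_H+\Omega_H^{-1}$, an ideal contained in $H$, and the residue of $H$ is $\operatorname{res}(H)=|H\setminus\operatorname{tr}(H)|$. The conductor ideal is $\mathcal{C}_H=\{h\in \mathbb{N}: h>F(H)\}$. Finally $n(H)=|\{x\in H: x<F(H)\}|$. *)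

(* Defs.v *)
From mathcomp Require Import all_boot all_order all_algebra.
From mathcomp Require Import finmap.
From mathcomp Require Import mathcomp_extra boolp classical_sets functions cardinality.
Set Implicit Arguments.
Unset Strict Implicit.
Unset Printing Implicit Defensive.
Import Order.TTheory GRing.Theory Num.Theory.
Local Open Scope classical_set_scope.
Local Open Scope ring_scope.

(* The field [ns_proper] is the standing assumption that the minimal number of
   generators is greater than 1. *)
Record numSemigroup := NumSemigroup {
  ns_set :> set nat;
  ns_zero : ns_set 0%N;
  ns_add : forall x y : nat, ns_set x -> ns_set y -> ns_set (x + y)%N;
  ns_cofinite : finite_set (~` ns_set);
  ns_proper : ns_set <> setT
}.

Definition max_ideal (H : numSemigroup) : set nat := ns_set H `\ 0%N.

Definition gaps (H : numSemigroup) : set nat := ~` ns_set H.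

(* Negative integers are never larger than a gap, and there is a gap, so the
   largest integer outside H is the largest gap (see [frobP]). *)
Definition frob (H : numSemigroup) : nat :=
  \max_(x <- fset_set (gaps H)) x.

Definition pseudo_frob (H : numSemigroup) : set nat :=
  [set f | gaps H f /\ forall m, max_ideal H m -> ns_set H (f + m)%N].

Definition ns_int (H : numSemigroup) : set int := [set h%:Z | h in ns_set H].

Definition canonical_ideal (H : numSemigroup) : set int :=
  [set - f%:Z + h%:Z | f in pseudo_frob H & h in ns_set H].

Definition anticanonical_ideal (H : numSemigroup) : set int :=
  [set x | forall w, canonical_ideal H w -> ns_int H (x + w)].

Definition trace (H : numSemigroup) : set int :=
  [set w + x | w in canonical_ideal H & x in anticanonical_ideal H].

Definition conductor (H : numSemigroup) : set int :=
  [set h%:Z | h in [set h : nat | (frob H < h)%N]].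

(* [fset_set] is the empty set on infinite sets; the two sets counted below are
   finite (see [finite_residue] and [finite_small]). *)
Definition residue (H : numSemigroup) : nat :=
  #|` fset_set (ns_int H `\` trace H)|%fset.

Definition num_small (H : numSemigroup) : nat :=
  #|` fset_set [set x : nat | ns_set H x /\ (x < frob H)%N]|%fset.

Lemma frobP (H : numSemigroup) :
  gaps H (frob H) /\ forall x, gaps H x -> (x <= frob H)%N.
Proof.
have fin : finite_set (gaps H) := @ns_cofinite H.
have le x : gaps H x -> (x <= frob H)%N.
  by move=> Gx; apply: leq_bigmax_seq => //; rewrite in_fset_set ?inE.
split=> //.
have [x Gx] : exists x, gaps H x.
  apply/not_existsP => noG; apply: (@ns_proper H).
  by apply/seteqP; split=> // x _; apply: contrapT; exact: noG.
have : (0 < size (fset_set (gaps H)))%N.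
  have : x \in enum_fset (fset_set (gaps H)) by rewrite in_fset_set ?inE.
  by case: (enum_fset _).
have mem s : (0 < size s)%N -> \max_(y <- s) y \in s.
  elim: s => // a [|b s] IH _; first by rewrite big_seq1 inE.
  rewrite big_cons inE; case: leqP => _; last by rewrite eqxx.
  by rewrite IH ?orbT.
by move/mem; rewrite in_fset_set // inE.
Qed.

Lemma conductor_sub_trace (H : numSemigroup) : conductor H `<=` trace H.
Proof.
have [GF maxF] := frobP H.
have big x : (frob H < x)%N -> ns_set H x.
  move=> Fx; apply: contrapT => /maxF; by rewrite leqNgt Fx.
move=> _ [h /= Fh <-].
exists (- (frob H)%:Z + 0%:Z).
  exists (frob H); last by exists 0%N => //; exact: ns_zero.
  split=> // m [_ m0]; apply: big.
  by rewrite -[X in (X < _)%N]addn0 ltn_add2l lt0n; apply/eqP.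
exists (h + frob H)%:Z; last by rewrite addr0 PoszD addrCA addNr addr0.
move=> _ [f [Gf _] [k Hk <-]].
have fF := maxF f Gf.
exists (h + (frob H - f) + k)%N; last by rewrite !PoszD -subzn // -!addrA.
by apply: big; rewrite -addnA ltn_addr.
Qed.

Lemma finite_residue (H : numSemigroup) :
  finite_set (ns_int H `\` trace H).
Proof.
apply: (@sub_finite_set _ _ ((fun h : nat => h%:Z) @` `I_(frob H).+1)).
  move=> _ [[h Hh <-] ntr]; exists h => //=.
  rewrite ltnS leqNgt; apply/negP => Fh; apply: ntr.
  by apply: conductor_sub_trace; exists h.
exact/finite_image/finite_II.
Qed.

Lemma finite_small (H : numSemigroup) :
  finite_set [set x : nat | ns_set H x /\ (x < frob H)%N].
Proof. by apply: (sub_finite_set _ (finite_II (frob H))) => x []. Qed.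

(* Main.v *)
(* An element of H \ tr(H) lies in H and is not in the conductor, since
   C_H is contained in tr(H); as F(H) is a gap, it is smaller than F(H). So
   H \ tr(H) is a subset of the n(H)-element set {x in H : x < F(H)}, and equal
   to it exactly when tr(H), which lies in H, contains nothing below F(H). *)
Require Import Defs.
From mathcomp Require Import all_boot all_order all_algebra.
From mathcomp Require Import finmap.
From mathcomp Require Import mathcomp_extra boolp classical_sets functions cardinality.

Local Open Scope classical_set_scope.

(** Placed in [int] so that it can be compared with [trace H]; as [Posz] is injective, it still has
    n(H) elements. *)
Definition small_elements (H : numSemigroup) : set int :=
  [set Posz h | h in [set x : nat | ns_set H x /\ (x < frob H)%N]].

Lemma finite_small_elements (H : numSemigroup) : finite_set (small_elements H).
Proof. exact/finite_image/finite_small. Qed.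

Lemma num_smallE (H : numSemigroup) :
  num_small H = #|` fset_set (small_elements H)|%fset.
Proof.
rewrite /num_small /small_elements fset_set_image; last exact: finite_small.
by rewrite card_imfset // => x y [].
Qed.

(** By definition, each element of the anti-canonical ideal translates the whole canonical ideal
    into H. *)
Lemma trace_sub (H : numSemigroup) : trace H `<=` ns_int H.
Proof. by move=> _ [w Ow [x Ix <-]]; rewrite GRing.addrC; exact: Ix. Qed.

Lemma mem_leq_frob (H : numSemigroup) (h : nat) :
  ns_set H h -> (h <= frob H)%N = (h < frob H)%N.
Proof.
move=> Hh; rewrite leq_eqVlt; case: eqP => //= hF.
by have [GF _] := frobP H; case: GF; rewrite -hF.
Qed.

Lemma residue_set_sub (H : numSemigroup) :
  ns_int H `\` trace H `<=` small_elements H.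
Proof.
move=> _ [[h Hh <-] ntr]; exists h => //; split=> //.
rewrite -mem_leq_frob // leqNgt; apply/negP => Fh.
by apply: ntr; apply: conductor_sub_trace; exists h.
Qed.

Lemma fset_residue_sub (H : numSemigroup) :
  (fset_set (ns_int H `\` trace H) `<=` fset_set (small_elements H))%fset.
Proof.
rewrite -fset_set_sub; [exact/residue_set_sub|exact: finite_residue|].
exact: finite_small_elements.
Qed.

(** A subset of a finite set with the same cardinality is the whole set. *)
Lemma residue_eq_num_small (H : numSemigroup) :
  residue H = num_small H <-> ns_int H `\` trace H = small_elements H.
Proof.
rewrite num_smallE /residue; split=> [e|->//].
apply/fset_set_inj; [exact: finite_residue|exact: finite_small_elements|].
apply/eqP; rewrite eqEfcard e leqnn andbT.
exact: fset_residue_sub.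
Qed.

Theorem corollary1p2 (H : numSemigroup) :
  (residue H <= num_small H)%N /\
  (residue H = num_small H <-> trace H = conductor H).
Proof.
split.
  by rewrite num_smallE; apply: fsubset_leq_card; exact: fset_residue_sub.
rewrite residue_eq_num_small; split=> [e|e].
  apply/seteqP; split; last exact: conductor_sub_trace.
  move=> z trz; have [h Hh hz] := trace_sub _ _ trz; rewrite -hz in trz *.
  exists h => //=; rewrite ltnNge mem_leq_frob //; apply/negP => hF.
  (* If [h] were below F(H), the equality [e] would put it outside tr(H), against [trz]. *)
  have : small_elements H (Posz h) by exists h.
  by rewrite -e => -[].
apply/seteqP; split; first exact: residue_set_sub.
move=> _ [h [Hh hF] <-]; split; first by exists h.
by rewrite e => -[k /= Fk [kh]]; move: Fk; rewrite kh ltnNge ltnW.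
Qed.
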